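(* Let $G$ be a finite group and let $\pi$ be a set of primes. Suppose that $K^2$ is a conjugacy class of $G$ for every conjugacy class $K$ of $G$ consisting of $\pi$-elements. Then $G/\mathbf{O}_{\pi'}(G)$ is nilpotent. In particular, if $\pi=\pi(G)$, then $G$ is nilpotent.
   Context: For a subset $K\subseteq G$, $K^2=\{ab : a,b\in K\}$. A $\pi$-element is an element whose order is divisible only by primes in $\pi$ (the identity is a $\pi$-element). $\pi'$ is the set of primes not in $\pi$, and $\mathbf{O}_{\pi'}(G)$ is the largest normal subgroup of $G$ whose order is not divisible by any prime in $\pi$. $\pi(G)$ is the set of primes dividing $|G|$. *)

(* Defs.v *)
From mathcomp Require Import all_boot all_fingroup all_solvable.

(* Main.v *)
Require Import Defs.
From mathcomp Require Import all_boot all_fingroup all_solvable.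
Set Implicit Arguments.
Unset Strict Implicit.
Unset Printing Implicit Defensive.
Local Open Scope group_scope.

(** The heart of the matter is that the hypothesis for the p-elements alone, for
a single prime p in pi, makes G / 'O_p^'(G) a p-group.

If the square of the class K of x is a class, it is the class of x^2, which is
no larger than K since 'C[x] centralises x^2; as it contains K x, it equals K x,
and likewise K y for every y in K.  Hence K is a coset of its stabiliser N under
right translation, and N is a normal subgroup of order #|K|
([square_class_coset]).  If x is central in a Sylow p-subgroup, #|K| is prime to
p, so N is a normal p'-subgroup; when 'O_p^'(G) is trivial, so is N, and x is
central in G ([square_class_central]).  As the hypothesis passes to quotients
([pelt_classes_square_quotient]), one may divide by 'O_p^'(G) and suppose it
trivial.  There is then a nontrivial central p-element whenever p divides #|G|;
factoring out the subgroup it generates keeps the p'-core trivial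
([pcore_quotient_central]), and induction shows that G is a p-group
([squaring_trivg_p'core]).

Finally, a subgroup H of G contained in [~: H, G] modulo 'O_pi^'(G) lies in
every 'O_p^'(G) with p in pi, because G / 'O_p^'(G) is nilpotent; so the normal
closure of H is a pi'-group and H lies in 'O_pi^'(G).  This says that
G / 'O_pi^'(G) is nilpotent ([nilpotent_quotient_p'cores]). *)

(** The coset is that of the right stabiliser of the class: all right translates
of the class by its own elements coincide with its square. *)
Lemma square_class_coset (gT : finGroupType) (G : {group gT}) (x : gT) :
  x \in G -> x ^: G * x ^: G \in classes G ->
  exists2 N : {group gT}, N <| G & x ^: G = N :* x.
Proof.
move=> Gx; set K := x ^: G => KK.
have Kx : x \in K by apply: class_refl.
have sKG : K \subset G by apply: class_subG.
have oKK : #|K * K| <= #|K|.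
  have xx : x * x \in K * K by apply: mem_mulg.
  case/imsetP: KK xx => y _ -> /class_eqP <-.
  rewrite -!index_cent1 dvdn_leq ?indexgS //.
  apply/subsetP=> g /setIP[Gg /cent1P cgx]; apply/setIP; split=> //.
  by apply/cent1P/commuteM.
have KzE z : z \in K -> K :* z = K * K.
  move=> Kz; apply/eqP; rewrite eqEcard card_rcoset oKK andbT.
  by apply: mulgS; rewrite sub1set.
(* 'Rs is right translation of subsets: N is the right stabiliser of K. *)
pose N := ('C_G[K | 'Rs])%G.
have NP g : reflect (g \in G /\ K :* g = K) (g \in N).
  apply: (iffP setIP) => -[Gg].
    by move/astab1P=> /=; rewrite rcosetE.
  by move=> Kg; split=> //; apply/astab1P; rewrite /= rcosetE.
have KJ g : g \in G -> K :^ g = K by apply: (normsP (class_norm x G)).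
have nNG : N <| G.
  rewrite /normal subsetIl; apply/subsetP=> g Gg; rewrite inE.
  apply/subsetP=> _ /imsetP[n /NP[Gn Kn] ->]; apply/NP; split.
    by rewrite groupJ.
  by rewrite -[in LHS](KJ g Gg) -conjg_set1 -conjsMg Kn KJ.
exists N => //; apply/eqP; rewrite eqEsubset; apply/andP; split.
  apply/subsetP=> y Ky; rewrite mem_rcoset; apply/NP; split.
    by rewrite groupM ?groupV ?(subsetP sKG).
  by rewrite rcosetM KzE // -(KzE x Kx) rcosetK.
rewrite norm_rlcoset ?(subsetP (normal_norm nNG)) //.
by apply/subsetP=> _ /lcosetP[n /NP[Gn <-] ->]; rewrite mem_rcoset mulgK.
Qed.

(** The stabiliser has the order of the class, which is prime to p. *)
Lemma square_class_central (gT : finGroupType) (G S : {group gT}) (p : nat) x :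
  p.-Sylow(G) S -> x \in 'Z(S) -> x ^: G * x ^: G \in classes G ->
  'O_p^'(G) = 1 -> x \in 'Z(G).
Proof.
move=> sylS /setIP[Sx cSx] KK trO; have sSG := pHall_sub sylS.
have Gx := subsetP sSG x Sx.
have [N nsNG defK] := square_class_coset Gx KK.
have p'N : p^'.-group N.
  rewrite /pgroup -(card_rcoset N x) -defK -index_cent1.
  have [_ _ p'i] := and3P sylS; apply: pnat_dvd p'i; apply: indexgS.
  by rewrite subsetI sSG sub_cent1.
have N1 : N :=: 1 by apply/trivgP; rewrite -trO pcore_max.
apply/setIP; split=> //; apply/centP=> g Gg; apply/commgP/conjg_fixP/set1P.
by rewrite -[[set x]]mul1g -N1 -defK memJ_class.
Qed.

(** By Schur-Zassenhaus the preimage of the core of the quotient is Z times a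
complement, which centralises Z and is therefore a characteristic subgroup of
that preimage. *)
Lemma pcore_quotient_central (gT : finGroupType) (G Z : {group gT})
    (pi : nat_pred) :
  Z \subset 'Z(G) -> pi.-group Z -> 'O_pi^'(G) = 1 -> 'O_pi^'(G / Z) = 1.
Proof.
move=> sZ piZ trO; have nsZG := sub_center_normal sZ.
have [H defH sZH nsHG] := inv_quotientN nsZG (pcore_normal pi^' (G / Z)).
have sHG := normal_sub nsHG.
have nsZH : Z <| H := normalS sZH sHG nsZG.
have pi'HZ : pi^'.-group (H / Z) by rewrite -defH pcore_pgroup.
have pi'i : pi^'.-nat #|H : Z|.
  by rewrite -card_quotient ?normal_norm.
have hallZ : pi.-Hall(H) Z by rewrite /pHall sZH piZ.
have /splitsP[K /complP[tiZK defZK]] :=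
  SchurZassenhaus_split (pHall_Hall hallZ) nsZH.
have sKH : K \subset H by rewrite -defZK mulG_subr.
have nsKH : K <| H.
  rewrite /normal sKH -defZK mulG_subG normG andbT cents_norm //.
  by rewrite (subset_trans (subset_trans sZ (subsetIr _ _))) // centS //;
    rewrite (subset_trans sKH).
have pi'K : pi^'.-group K.
  have nZK : K \subset 'N(Z) := subset_trans sKH (normal_norm nsZH).
  rewrite /pgroup (card_isog (quotient_isog nZK tiZK)).
  by rewrite /= -(quotientMidl Z K) defZK.
have K1 : K :=: 1.
  apply/trivgP; rewrite -trO (subset_trans (pcore_max pi'K nsKH)) //.
  by rewrite pcore_max ?pcore_pgroup // (char_normal_trans (pcore_char _ _)).
by rewrite defH -defZK K1 mulg1 trivg_quotient.
Qed.

Definition pelt_classes_square (pi : nat_pred) (gT : finGroupType)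
    (G : {group gT}) :=
  forall x, x \in G -> pi.-elt x -> x ^: G * x ^: G \in classes G.

(** A pi-element of the quotient is the image of the pi-part of any preimage. *)
Lemma pelt_classes_square_quotient (pi : nat_pred) (gT : finGroupType)
    (G N : {group gT}) :
  N <| G -> pelt_classes_square pi G -> pelt_classes_square pi (G / N).
Proof.
move=> nsNG sqG _ /morphimP[y Ny Gy ->] piy; have nNG := normal_norm nsNG.
have Gx : y.`_pi \in G by rewrite groupX.
have Nx := subsetP nNG _ Gx.
rewrite /= -(constt_p_elt piy) -morph_constt //.
have /imsetP[z Gz defKK] := sqG _ Gx (p_elt_constt pi y).
rewrite -quotient_class // -quotientMl; last first.
  by rewrite (subset_trans _ nNG) ?class_subG.
by rewrite defKK quotient_class ?(subsetP nNG) // mem_classes ?mem_quotient.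
Qed.

(** A nontrivial element of the centre of a Sylow p-subgroup is central in G;
the quotient by the subgroup it generates inherits both hypotheses. *)
Lemma squaring_trivg_p'core (p : nat) (gT : finGroupType) (G : {group gT}) :
  pelt_classes_square p G -> 'O_p^'(G) = 1 -> p.-group G.
Proof.
have [n] := ubnP #|G|; elim: n gT G => // n IHn gT G leGn sqG trO.
have [S sylS] := Sylow_exists p G.
have pS := pHall_pgroup sylS; have sSG := pHall_sub sylS.
have [S1 | ntS] := eqVneq S 1%G.
  have p'G : p^'.-group G.
    by have [_ _] := and3P sylS; rewrite S1 indexg1.
  by rewrite -(pcore_pgroup_id p'G) trO pgroup1.
have /trivgPn[x Zx ntx] : 'Z(S) != 1 by rewrite (center_nil_eq1 (pgroup_nil pS)).
have Sx : x \in S := subsetP (center_sub S) x Zx.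
have px : p.-elt x := mem_p_elt pS Sx.
have ZGx : x \in 'Z(G).
  exact: square_class_central sylS Zx (sqG x (subsetP sSG x Sx) px) trO.
have sXZ : <[x]> \subset 'Z(G) by rewrite cycle_subG.
have nsXG := sub_center_normal sXZ.
rewrite -(pquotient_pgroup px (normal_norm nsXG)).
apply: IHn; last exact: pcore_quotient_central.
  apply: leq_trans (ltn_quotient _ (normal_sub nsXG)) _ => //.
  by rewrite cycle_eq1.
exact: pelt_classes_square_quotient.
Qed.

(** G / 'O_pi^'(G) embeds in the product of the quotients G / 'O_p^'(G). *)
Lemma nilpotent_quotient_p'cores (pi : nat_pred) (gT : finGroupType)
    (G : {group gT}) :
    {in pi, forall p : nat, nilpotent (G / 'O_p^'(G))} ->
  nilpotent (G / 'O_pi^'(G)).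
Proof.
move=> nilG; set N := 'O_pi^'(G).
have nsNG : N <| G := pcore_normal _ _.
apply/forall_inP=> Hb; rewrite subsetI => /andP[sHbG sHbR].
have [H defH sNH sHG] := inv_quotientS nsNG sHbG.
have nNG := normal_norm nsNG; have nNH := subset_trans sHG nNG.
have sHR : H \subset N * [~: H, G].
  by rewrite -quotientSK // quotientR // -defH.
suffices sHN : H \subset N by rewrite defH quotientS1.
have sHp p : p \in pi -> H \subset 'O_p^'(G).
  move=> pi_p; set M := 'O_p^'(G).
  have nMG : G \subset 'N(M) := normal_norm (pcore_normal _ _).
  have nMH := subset_trans sHG nMG.
  have sNM : N \subset M.
    by apply: sub_pcore => q; apply: contra => /eqP->.
  rewrite -quotient_sub1 //; apply/trivgP/eqP.
  apply: (implyP (forallP (nilG p pi_p) (H / M)%G)).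
  rewrite subsetI quotientS //= -quotientR // quotientSK //.
  exact: subset_trans sHR (mulSg _ sNM).
(* H need not be normal in G, but its normal closure lies in the same cores. *)
pose L := <<class_support H G>>%G.
have sHL : H \subset L := subset_trans (sub_class_support _ _) (subset_gen _).
have nsLG : L <| G.
  rewrite /normal gen_subG class_support_subG //=.
  by rewrite norms_gen ?class_support_norm.
rewrite (subset_trans sHL) // pcore_max //.
apply/pgroupP=> p p_pr pL; apply: contraL pL => pi_p.
rewrite -p'natE //; apply: pgroupS (pcore_pgroup p^' G).
by rewrite gen_subG class_support_sub_norm ?sHp ?gFnorm.
Qed.

Theorem corollaryE (gT : finGroupType) (G : {group gT}) (pi : nat_pred)
    (pi_primes : {subset pi <= prime})
    (sqr_class : forall K : {set gT}, K \in classes G ->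
       {in K, forall x, pi.-elt x} -> K * K \in classes G) :
  nilpotent (G / 'O_pi^'(G)) /\ (pi =i \pi(G) -> nilpotent G).
Proof.
have nilQ : nilpotent (G / 'O_pi^'(G)).
  apply: nilpotent_quotient_p'cores => p pi_p; apply: (@pgroup_nil _ p).
  apply: squaring_trivg_p'core; last exact: trivg_pcore_quotient.
  apply: pelt_classes_square_quotient (pcore_normal _ _) _ => x Gx px.
  apply: sqr_class (mem_classes Gx) _ => _ /imsetP[g _ ->].
  by rewrite p_eltJ; apply: sub_p_elt px => q /eqnP->.
split=> // defpi.
have O1 : 'O_pi^'(G) = 1.
  apply: card1_trivg; apply: (@pnat_1 pi); last exact: pcore_pgroup.
  by apply: pgroupS (pcore_sub _ _) _; rewrite (eq_pgroup _ defpi) pgroup_pi.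
by rewrite (isog_nil (quotient1_isog G)) -O1.
Qed.
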